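(* Consider the causal adversarial multi-path network model with passive feedback described in the context, with $C$ unit-capacity links and additive jamming, where both reliability and perfect secrecy are required. For any $\vec z=(z_{rw},z_{ro},z_{wo})$ with $z_{rw}+z_{ro}+z_{wo}\le C$, writing $z_r=z_{rw}+z_{ro}$ and $z_w=z_{rw}+z_{wo}$, the capacity for simultaneous reliability and secrecy is $$R=\begin{cases} \max\{0,\,C-z_r\} & \text{if } z_r\ge z_w,\\ \max\{0,\,C-z_w\} & \text{if } z_w>z_r.\end{cases}$$
   Context: Model. A sender (Alice) communicates with a receiver (Bob) over $C$ parallel directed noiseless links $L_1,\dots,L_C$, each of unit capacity (large-alphabet regime). A code of block length $n$ and rate $R$ has message $M$ uniform on $\{0,1\}^{nR}$ and uses private randomness of Alice unknown to the adversary. Passive feedback: the code may operate in $r\ge1$ rounds of lengths summing to $n$; in round $k$ Alice's codewords $\vec X^{(k)}_1,\dots,\vec X^{(k)}_C$ are functions of the message, her randomness, and all words received by Bob in earlier rounds (Alice observes everything Bob receives, causally). Bob decodes $\hat M$ from all received words. Adversary. Calvin, who knows the coding scheme, selects pairwise disjoint link sets $Z_{rw},Z_{ro},Z_{wo}$ (unknown to Alice and Bob) with $|Z_{rw}|\le z_{rw}$, $|Z_{ro}|\le z_{ro}$, $|Z_{wo}|\le z_{wo}$; he reads the links in $Z_r=Z_{rw}\cup Z_{ro}$ and jams the links in $Z_w=Z_{rw}\cup Z_{wo}$. He is causal: his jamming at time $t$ may depend only on symbols observed on $Z_r$ up to time $t$. Under additive jamming $\vec Y_i=\vec X_i+\vec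 E_i$ with $\vec E_i$ chosen by Calvin and $\vec E_i=0$ for $i\notin Z_w$ (so Calvin does not learn Bob's received symbols on links of $Z_{wo}$). Reliability and secrecy. Rate $R$ is achievable if for every $\varepsilon>0$ and all sufficiently large $n$ there is such a code with $\Pr[\hat M\ne M]<\varepsilon$ against every admissible causal adversary and such that the message is perfectly secret from Calvin, i.e. the mutual information between $M$ and everything Calvin observes on the links of $Z_r$ (over all rounds) is zero. The capacity is the supremum of achievable rates. *)

(* Defs.v *)
From HB Require Import structures.
From mathcomp Require Import all_boot all_order all_algebra.
From mathcomp Require Import reals exp.

Set Implicit Arguments.
Unset Strict Implicit.
Unset Printing Implicit Defensive.

Import Order.TTheory GRing.Theory Num.Theory.
Local Open Scope ring_scope.

(* Alphabet: one channel use of a link carries one symbol of F_{2^m},       *)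
(* represented by its additive group F_2^m (additive jamming = addition).   *)
(* A link thus carries m bits per channel use ("unit capacity" in units of  *)
(* log q, q = 2^m; the large-alphabet regime lets the code choose m).        *)
Definition sym (m : nat) := 'rV['F_2]_m.

(* A history of the C links: (time, link) -> symbol; only times < N matter. *)
Definition hist (C m : nat) := nat -> 'I_C -> sym m.

Definition upd (C m : nat) (h : hist C m) (t : nat) (v : 'I_C -> sym m)
  : hist C m := fun u j => if u == t then v j else h u j.

Section Model.
Variable R : realType.
Variables (C N m : nat).

Record code (len : nat) := Code {
  kbits : nat;
  rnd : finType;                       (* Alice's private randomness *)
  rdist : rnd -> R;
  rstart : nat -> nat;                 (* rstart t = first time of the round
                                          containing time t *)
  enc : nat -> 'I_C -> kbits.-tuple bool -> rnd -> hist C m -> sym m;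
        (* enc t i msg s y = symbol sent at time t on link i, given the
           words y received by Bob (only earlier rounds may be used) *)
  dec : hist C m -> kbits.-tuple bool
}.
Arguments kbits {len}.
Arguments rnd {len}.
Arguments rstart {len}.
Arguments rdist {len}.
Arguments enc {len}.
Arguments dec {len}.

(* Rounds: consecutive intervals partitioning the times 0..N-1. *)
Definition rounds_ok (rs : nat -> nat) :=
  rs 0 = 0%N /\
  (forall t, (t < N)%N -> (rs t <= t)%N) /\
  (forall t, (0 < t < N)%N -> rs t = t \/ rs t = rs t.-1).

Definition code_ok (c : code N) :=
  (forall s, 0 <= rdist c s) /\ (\sum_(s : rnd c) rdist c s = 1) /\
  rounds_ok (rstart c) /\
  (* passive feedback: round-k codewords depend only on what Bob received
     in earlier rounds *)
  (forall t i msg s (y y' : hist C m),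
      (forall u j, (u < rstart c t)%N -> y u j = y' u j) ->
      enc c t i msg s y = enc c t i msg s y').

(* Calvin: read-write, read-only, write-only link sets and a jamming map. *)
Record adversary := Adv {
  Zrw : {set 'I_C}; Zro : {set 'I_C}; Zwo : {set 'I_C};
  jam : nat -> 'I_C -> hist C m -> sym m
        (* jam t i x = error symbol E_i(t), as a function of the symbols
           transmitted so far (only those on Z_r at times <= t may be used) *)
}.
Arguments jam : clear implicits.

Definition Zr (a : adversary) := Zrw a :|: Zro a.
Definition Zw (a : adversary) := Zrw a :|: Zwo a.

Definition adv_ok (zrw zro zwo : nat) (a : adversary) :=
  [disjoint Zrw a & Zro a] /\ [disjoint Zrw a & Zwo a] /\
  [disjoint Zro a & Zwo a] /\
  (#|Zrw a| <= zrw)%N /\ (#|Zro a| <= zro)%N /\ (#|Zwo a| <= zwo)%N /\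
  (* causality: jamming at time t depends only on symbols observed on Z_r
     up to time t *)
  (forall t i (x x' : hist C m),
      (forall u j, (u <= t)%N -> j \in Zr a -> x u j = x' u j) ->
      jam a t i x = jam a t i x').

(* Execution: (transmitted words X, received words Y) after k time steps. *)
Fixpoint run (c : code N) (a : adversary) (msg : (kbits c).-tuple bool)
  (s : rnd c) (k : nat) : hist C m * hist C m :=
  match k with
  | 0 => (fun _ _ => 0, fun _ _ => 0)
  | k'.+1 =>
      let xy := run a msg s k' in
      let x' := upd xy.1 k' (fun i => enc c k' i msg s xy.2) in
      let y' := upd xy.2 k'
          (fun i => enc c k' i msg s xy.2
                    + (if i \in Zw a then jam a k' i x' else 0)) in
      (x', y')
  end.

Definition msg_prob (c : code N) : R := ((2 ^ kbits c)%:R)^-1.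

Definition perr (c : code N) (a : adversary) : R :=
  \sum_(msg : (kbits c).-tuple bool) \sum_(s : rnd c)
     msg_prob c * rdist c s * (dec c (run a msg s N).2 != msg)%:R.

Definition obs (c : code N) (a : adversary) (msg : (kbits c).-tuple bool)
  (s : rnd c) : {ffun 'I_N * 'I_C -> sym m} :=
  [ffun p : 'I_N * 'I_C => if p.2 \in Zr a then (run a msg s N).1 (nat_of_ord p.1) p.2 else 0].

Definition pjoint (c : code N) (a : adversary) (msg : (kbits c).-tuple bool)
  (o : {ffun 'I_N * 'I_C -> sym m}) : R :=
  \sum_(s : rnd c) msg_prob c * rdist c s * (obs a msg s == o)%:R.

Definition pobs (c : code N) (a : adversary)
  (o : {ffun 'I_N * 'I_C -> sym m}) : R :=
  \sum_(msg : (kbits c).-tuple bool) pjoint a msg o.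

Definition mutinf (c : code N) (a : adversary) : R :=
  \sum_(msg : (kbits c).-tuple bool) \sum_(o : {ffun 'I_N * 'I_C -> sym m})
     (if pjoint a msg o == 0 then 0
      else pjoint a msg o * ln (pjoint a msg o / (msg_prob c * pobs c a o))).

End Model.

Definition achievable (R : realType) (C zrw zro zwo : nat) (Rt : R) : Prop :=
  forall eps : R, 0 < eps ->
  exists N0 : nat, forall N : nat, (N0 <= N)%N ->
  exists m : nat, (0 < m)%N /\
  exists c : code R C m N,
    code_ok c /\
    Rt * (N * m)%:R <= (kbits c)%:R /\
    forall a : adversary C m, adv_ok zrw zro zwo a ->
      perr c a < eps /\ mutinf c a = 0.

Definition is_sup (R : realType) (P : R -> Prop) (c : R) : Prop :=
  (forall x, P x -> x <= c) /\
  (forall e, 0 < e -> exists x, P x /\ c - e < x).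

Definition capacity (R : realType) (C zrw zro zwo : nat) (c : R) : Prop :=
  is_sup (achievable C zrw zro zwo) c.

(* Main.v *)
Require Import Defs.
From HB Require Import structures.
From mathcomp Require Import all_boot all_order all_algebra all_field.
From mathcomp Require Import boolp reals exp.
From mathcomp Require Import zify lra.
Import Order.TTheory GRing.Theory Num.Theory.
Local Open Scope ring_scope.

Set Implicit Arguments.
Unset Strict Implicit.
Unset Printing Implicit Defensive.

(* Let D = C - max(z_r, z_w).

   Converse. If Calvin blanks the links of Z_rw and adds a uniform pad to those
   of Z_wo, only C - z_w links carry information to Bob. If he only listens,
   perfect secrecy makes the message independent of the z_r links he reads, so
   Bob learns it from the C - z_r others.

   Achievability. Passive feedback makes the words received by Bob common to
   Alice and Bob, while Calvin knows them on Z_r only. Call a link burnt once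
   Alice has seen it jammed. On burnt links she sends fresh noise, and the noise
   received at one time is a shared key for the next one. At each data time, the
   keys on burnt links and the symbols sent on the others form together a word
   with D prescribed MDS parity checks, the message symbols; since any C - D
   coordinates of that word are free, Calvin learns nothing. To decode, Bob only
   needs to know when each link was first jammed and the error made there.
   Alice repeats this on every link, and vouches for the links that delivered it
   correctly by sending there a password, a sum of received noise over all
   links. Calvin misses a summand, so he forges it with probability 2^-m. *)

(** * Executions *)

Section Executions.
Variables (R : realType) (C N m : nat).
Implicit Types (c : code R C m N) (a : adversary C m) (X Y : hist C m).

Definition jam_causal a := forall t i (x x' : hist C m),
  (forall u j, (u <= t)%N -> j \in Zr a -> x u j = x' u j) ->
  jam a t i x = jam a t i x'.

Lemma adv_ok_causal zrw zro zwo a : adv_ok zrw zro zwo a -> jam_causal a.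
Proof. by case=> _ [_ [_ [_ [_ [_]]]]]. Qed.

Definition err a X t i := if i \in Zw a then jam a t i X else 0.

Lemma err_causal a X X' t i : jam_causal a ->
    (forall u j, (u <= t)%N -> j \in Zr a -> X u j = X' u j) ->
  err a X t i = err a X' t i.
Proof. by rewrite /err => ja e; case: ifP => // _; apply: ja. Qed.

(** A run as a system of equations on complete histories. [run_exec] and [exec_uniq] give its
    existence and uniqueness, so checking the equations identifies a run. *)
Definition exec c a msg s X Y := forall t i, (t < N)%N ->
  X t i = enc (c := c) t i msg s Y /\ Y t i = X t i + err a X t i.

Lemma enc_causal c t i msg s (y y' : hist C m) : code_ok c -> (t < N)%N ->
    (forall u j, (u < t)%N -> y u j = y' u j) ->
  enc (c := c) t i msg s y = enc t i msg s y'.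
Proof.
move=> [_ [_ [[_ [rs _]] ce]]] tN e; apply: ce => u j ut.
by apply: e; apply: leq_trans ut (rs _ tN).
Qed.

Lemma run_stable c a msg s k t i : (t < k)%N ->
  (run (c := c) a msg s k).1 t i = (run a msg s t.+1).1 t i /\
  (run (c := c) a msg s k).2 t i = (run a msg s t.+1).2 t i.
Proof.
elim: k => // k IH; rewrite ltnS leq_eqVlt => /predU1P[-> //|tk].
by have [<- <-] := IH tk; rewrite /= /upd (ltn_eqF tk).
Qed.

Lemma run_out c a msg s k t i : (k <= t)%N ->
  (run (c := c) a msg s k).1 t i = 0 /\ (run (c := c) a msg s k).2 t i = 0.
Proof.
elim: k => // k IH kt; have [x0 y0] := IH (ltnW kt).
by rewrite /= /upd (gtn_eqF kt).
Qed.

Lemma run_exec c a msg s : code_ok c -> jam_causal a ->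
  exec (c := c) a msg s (run a msg s N).1 (run a msg s N).2.
Proof.
move=> cok ja t i tN.
have stab k u j : (u < k)%N -> (k <= N)%N ->
    (run (c := c) a msg s k).1 u j = (run a msg s N).1 u j /\
    (run (c := c) a msg s k).2 u j = (run a msg s N).2 u j.
  move=> uk kN; have [-> ->] := run_stable a msg s j uk.
  by have [-> ->] := run_stable a msg s j (leq_trans uk kN).
have [<- <-] := stab t.+1 t i (ltnSn t) tN.
rewrite /= /upd eqxx.
have -> : enc (c := c) t i msg s (run a msg s t).2 =
          enc t i msg s (run a msg s N).2.
  by apply: enc_causal => // u j ut; have [] := stab t u j ut (ltnW tN).
split=> //; congr (_ + _); apply: err_causal => // u j ut jr.
case: eqP => [->|/eqP ne]; last first.
  by have [|] := stab t u j _ (ltnW tN); rewrite // ltn_neqAle ne.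
have [<- _] := stab t.+1 t j (ltnSn t) tN.
by rewrite /= /upd eqxx.
Qed.

Lemma exec_uniq c a msg s X Y X' Y' : code_ok c -> jam_causal a ->
    exec (c := c) a msg s X Y -> exec (c := c) a msg s X' Y' ->
  forall t i, (t < N)%N -> X t i = X' t i /\ Y t i = Y' t i.
Proof.
move=> cok ja e e'; elim/ltn_ind => t IH i tN.
have eX j : X t j = X' t j.
  have [-> _] := e t j tN; have [-> _] := e' t j tN.
  by apply: enc_causal => // u l ut; have [] := IH u ut l (ltn_trans ut tN).
split=> //; have [_ ->] := e t i tN; have [_ ->] := e' t i tN; rewrite eX.
congr (_ + _); apply: err_causal => // u j; rewrite leq_eqVlt.
by case/predU1P=> [-> //|ut _]; have [] := IH u ut j (ltn_trans ut tN).
Qed.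

End Executions.

(** * Vanishing mutual information *)

Section MutualInformation.
Variables (R : realType).

(** The pointwise Gibbs inequality with its equality case, from [1 + x < expR x] at a nonzero
    [x = ln (q / p)]. *)
Lemma gibbs_term (p q : R) : 0 <= p -> 0 <= q -> (q = 0 -> p = 0) ->
  let f := if p == 0 then 0 else p * ln (p / q) in
  p - q <= f /\ (p - q = f -> p = q).
Proof.
move=> p0 q0 qp /=; have [->|pn0] := eqVneq p 0.
  by rewrite sub0r oppr_le0; split=> // /eqP; rewrite oppr_eq0 => /eqP.
have pgt0 : 0 < p by rewrite lt0r pn0.
have qgt0 : 0 < q.
  by rewrite lt0r q0 andbT; apply: contraNneq pn0 => /qp ->.
have lnE : ln (p / q) = - ln (q / p).
  by rewrite -[p / q]invf_div lnV // posrE divr_gt0.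
have := @lnK R (q / p); rewrite posrE divr_gt0 // lnE => /(_ isT).
have [->|un0] := eqVneq (ln (q / p)) 0.
  rewrite expR0 => /esym /divr1_eq ->.
  by rewrite oppr0 mulr0 subrr.
move=> eu; have := expR_gt1Dx un0; rewrite eu ltr_pdivlMr // => lt.
have lt' : p - q < p * - ln (q / p) by rewrite mulrN; nra.
by split; [apply: ltW | move=> e; rewrite e ltxx in lt'].
Qed.

Variables (C N m : nat) (c : code R C m N) (a : adversary C m).
Hypothesis cok : code_ok c.

Lemma msg_prob_gt0 : 0 < msg_prob c.
Proof. by rewrite invr_gt0 ltr0n expn_gt0. Qed.

Lemma sum_msg_prob : \sum_(msg : (kbits c).-tuple bool) msg_prob c = 1.
Proof.
rewrite sumr_const card_tuple card_bool -[LHS]mulr_natl mulfV //.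
by rewrite pnatr_eq0 -lt0n expn_gt0.
Qed.

Lemma pjoint_ge0 msg o : 0 <= pjoint (c := c) a msg o.
Proof.
case: cok => rd0 _; apply: sumr_ge0 => s _.
by rewrite !mulr_ge0 ?ler0n // ltW ?msg_prob_gt0.
Qed.

(** Summing [gibbs_term] bounds the mutual information below by a difference of two equal total
    masses. When it vanishes, every term is an equality. *)
Lemma mutinf_eq0P :
  mutinf c a = 0 <->
  (forall msg o, pjoint (c := c) a msg o = msg_prob c * pobs c a o).
Proof.
set f := fun u : (kbits c).-tuple bool * {ffun 'I_N * 'I_C -> sym m} =>
  if pjoint a u.1 u.2 == 0 then 0
  else pjoint a u.1 u.2 * ln (pjoint a u.1 u.2 / (msg_prob c * pobs c a u.2)).
have miE : mutinf c a = \sum_u f u.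
  exact: (pair_bigA _ (fun msg o => f (msg, o))).
split=> [mi0 msg o|indep]; last first.
  rewrite miE big1 // => -[msg o] _; rewrite /f /= -(indep msg o).
  by have [//|n0] := eqVneq; rewrite divff // ln1 mulr0.
set p := fun u : (kbits c).-tuple bool * {ffun 'I_N * 'I_C -> sym m} =>
  pjoint a u.1 u.2.
set q := fun u : (kbits c).-tuple bool * {ffun 'I_N * 'I_C -> sym m} =>
  msg_prob c * pobs c a u.2.
have q0 u : 0 <= q u.
  apply: mulr_ge0; first exact/ltW/msg_prob_gt0.
  by apply: sumr_ge0 => i _; apply: pjoint_ge0.
have qp u : q u = 0 -> p u = 0.
  move/eqP; rewrite mulf_eq0 gt_eqF ?msg_prob_gt0 //= => /eqP po.
  have := psumr_eq0P _ po; rewrite /p; case: u po => msg' o' /= po; apply=> //.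
  by move=> ? _; apply: pjoint_ge0.
have G u : p u - q u <= f u /\ (p u - q u = f u -> p u = q u).
  by apply: gibbs_term => //; [apply: pjoint_ge0 | apply: qp].
have sumpq : \sum_u (p u - q u) = 0.
  rewrite sumrB -(pair_bigA _ (fun msg o => pjoint a msg o)) /=.
  rewrite -(pair_bigA _ (fun _ o => msg_prob c * pobs c a o)) /=.
  rewrite [X in X - _]exchange_big /= [X in _ - X]exchange_big /= -sumrB.
  apply: big1 => o' _; rewrite -mulr_suml sum_msg_prob mul1r.
  by rewrite /pobs subrr.
have sum0 : \sum_u (f u - (p u - q u)) = 0.
  by rewrite sumrB sumpq -miE mi0 subrr.
have /eqP : f (msg, o) - (p (msg, o) - q (msg, o)) = 0.
  by apply: (psumr_eq0P _ sum0) => // u _; rewrite subr_ge0; case: (G u).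
by rewrite subr_eq0 => /eqP /esym; case: (G (msg, o)) => _; apply.
Qed.

End MutualInformation.

(** * Converse *)

Lemma card_sym m : #|{: sym m}| = (2 ^ m)%N.
Proof. by rewrite card_mx card_Fp // mul1n. Qed.

Lemma sum_bool_card (T : finType) (P : pred T) :
  (\sum_i P i = #|[pred i | P i]|)%N.
Proof.
rewrite -sum1_card [RHS]big_mkcond; apply: eq_bigr => i _.
by rewrite inE; case: (P i).
Qed.

(** Success probability above 1/2 bounds the number of bits exactly, because a ratio of powers of 2
    below 1 is at most 1/2. *)
Lemma half_lt_expn (R : realType) k d :
  1 / 2 < ((2 ^ k)%:R)^-1 * (2 ^ d)%:R :> R -> (k <= d)%N.
Proof.
rewrite leqNgt => lt; apply/negP => dk; move: lt.
rewrite [ltRHS]mulrC ltr_pdivlMr ?ltr0n ?expn_gt0 //.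
have : (2 ^ d.+1)%:R <= (2 ^ k)%:R :> R by rewrite ler_nat leq_exp2l.
by rewrite expnS natrM; lra.
Qed.

Lemma card_notin (C : nat) (S : {set 'I_C}) :
  #|[pred x | x \notin S]| = (C - #|S|)%N.
Proof.
have := cardsC S; rewrite card_ord => cS.
rewrite -[#|_|](addKn #|S|); congr (_ - _)%N; rewrite -[RHS]cS.
by congr (_ + _)%N; apply: eq_card => i; rewrite !inE.
Qed.

Section Converse.
Variables (R : realType) (C N m : nat).
Implicit Types (c : code R C m N) (a : adversary C m) (X Y : hist C m).

Lemma run_ext c a msg s a' msg' s' :
    (forall t i, (t < N)%N ->
       (run (c := c) a msg s N).2 t i = (run (c := c) a' msg' s' N).2 t i) ->
  (run (c := c) a msg s N).2 = (run (c := c) a' msg' s' N).2.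
Proof.
move=> e; apply: funext => t; apply: funext => i.
case: (ltnP t N) => [/e //|Nt].
by have [_ ->] := run_out a msg s i Nt; have [_ ->] := run_out a' msg' s' i Nt.
Qed.

Definition success c a msg s := dec c (run (c := c) a msg s N).2 == msg.

Definition psucc c a : R := \sum_(msg : (kbits c).-tuple bool) \sum_(s : rnd c)
  msg_prob c * rdist s * (success a msg s)%:R.

Lemma perr_psucc c a : code_ok c -> perr c a = 1 - psucc c a.
Proof.
move=> cok; apply/eqP; rewrite eq_sym subr_eq -big_split /=; apply/eqP.
rewrite -[LHS](sum_msg_prob c); apply: eq_bigr => msg _; rewrite -big_split /=.
have [_ [rd1 _]] := cok; rewrite -[LHS]mulr1 -[X in _ * X]rd1 mulr_sumr.
apply: eq_bigr => s _; rewrite -mulrDr -natrD /success.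
by case: eqP; rewrite /= mulr1.
Qed.

(** * Rate bound from jamming *)

Section OneTimePad.
Variables (c : code R C m N) (A B : {set 'I_C}).
Hypotheses (cok : code_ok c) (disjAB : [disjoint A & B]).
Let Off := {i : 'I_C | i \notin A :|: B}.

(* Calvin is deterministic: the pad e is fixed, and uniform only on average over
   the adversaries [pad_adv e]. *)
Definition pad_adv (e : {ffun 'I_N * 'I_C -> sym m}) : adversary C m :=
  Adv A set0 B (fun t i x => if i \in A then - x t i
    else if insub t is Some t' then e (t', i) else 0).

Lemma pad_causal e : jam_causal (pad_adv e).
Proof.
move=> t i x x' H /=; case: ifP => // iA; congr (- _); apply: H => //.
by rewrite /Zr inE iA.
Qed.

Lemma pad_run e msg s t i : (t < N)%N ->
  (run (c := c) (pad_adv e) msg s N).2 t i =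
  if i \in A then 0 else
  (run (c := c) (pad_adv e) msg s N).1 t i +
  (if i \in B then if insub t is Some t' then e (t', i) else 0 else 0).
Proof.
move=> tN; have [_ ->] := run_exec msg s cok (@pad_causal e) i tN.
by rewrite /err /Zw inE /=; have [] := boolP (i \in A); rewrite ?subrr.
Qed.

(** Storing the pad itself off [B] makes the second component a full array, whose count cancels
    against the number of pads averaged over. *)
Definition pad_view s
    (u : (kbits c).-tuple bool * {ffun 'I_N * 'I_C -> sym m}) :
    {ffun 'I_N * Off -> sym m} * {ffun 'I_N * 'I_C -> sym m} :=
  let Y := (run (pad_adv u.2) u.1 s N).2 in
  ([ffun p : 'I_N * Off => Y (p.1 : nat) (val p.2)],
   [ffun p : 'I_N * 'I_C => if p.2 \in B then Y (p.1 : nat) p.2 else u.2 p]).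

(** The view determines all received words, since Bob gets 0 on [A]. Successful decoding recovers
    the message; then the sent words are known, and the pad on [B] is received minus sent. *)
Lemma pad_view_inj s :
  {in [pred u | success (pad_adv u.2) u.1 s] &, injective (pad_view s)}.
Proof.
move=> [msg e] [msg' e']; rewrite !inE /success /= => /eqP sm /eqP sm' [].
move=> /ffunP eq1 /ffunP eq2.
have eY : (run (c := c) (pad_adv e) msg s N).2 =
          (run (c := c) (pad_adv e') msg' s N).2.
  apply: run_ext => t i tN; have [iA|iA] := boolP (i \in A).
    by rewrite !pad_run // iA.
  have [iB|iB] := boolP (i \in B).
    by have := eq2 (Ordinal tN, i); rewrite !ffunE /= iB.
  have iAB : i \notin A :|: B by rewrite inE (negbTE iA).
  by have := eq1 (Ordinal tN, Sub i iAB); rewrite !ffunE.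
have em : msg = msg' by rewrite -sm -sm' eY.
rewrite -{}em in eY eq2 sm' *; congr (_, _); apply/ffunP => -[t i].
have [iB|iB] := boolP (i \in B); last first.
  by have := eq2 (t, i); rewrite !ffunE /= (negbTE iB).
have iA : i \notin A by rewrite (disjointFl disjAB iB).
have := pad_run e msg s i (ltn_ord t); have := pad_run e' msg s i (ltn_ord t).
rewrite (negbTE iA) iB -eY valK => ->.
have [-> _] := run_exec msg s cok (@pad_causal e') i (ltn_ord t).
have [-> _] := run_exec msg s cok (@pad_causal e) i (ltn_ord t).
by rewrite eY => /addrI.
Qed.

Lemma pad_bound :
    (forall e, 1 / 2 < psucc c (pad_adv e)) ->
  (kbits c <= N * m * (C - #|A :|: B|))%N.
Proof.
pose P := {ffun 'I_N * 'I_C -> sym m}; pose W := {ffun 'I_N * Off -> sym m}.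
move=> H; have : \sum_(e : P) (1 / 2 : R) < \sum_(e : P) psucc c (pad_adv e).
  apply: ltr_sum => //.
  by apply/hasP; exists [ffun=> 0]; rewrite ?mem_index_enum.
have up : \sum_(e : P) psucc c (pad_adv e) <= msg_prob c * (#|W| * #|P|)%:R.
  rewrite exchange_big /=.
  under eq_bigr => msg _ do rewrite exchange_big /=.
  rewrite exchange_big /=; have [rd0 [rd1 _]] := cok.
  have -> : msg_prob c * (#|W| * #|P|)%:R =
      \sum_(s : rnd c) rdist s * (msg_prob c * (#|W| * #|P|)%:R).
    by rewrite -mulr_suml rd1 mul1r.
  apply: ler_sum => s _.
  rewrite pair_bigA /=; under eq_bigr => u _ do rewrite -mulrA mulrCA.
  rewrite -mulr_sumr ler_wpM2l // -mulr_sumr ler_wpM2l //.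
    exact/ltW/msg_prob_gt0.
  rewrite -natr_sum ler_nat -card_prod sum_bool_card.
  exact: leq_card_in (@pad_view_inj s).
move=> /lt_le_trans /(_ up).
rewrite sumr_const -[X in X < _]mulr_natl natrM mulrA [X in X < _]mulrC.
rewrite ltr_pM2r; last first.
  by rewrite ltr0n; apply/card_gt0P; exists [ffun=> 0].
rewrite card_ffun card_prod card_ord card_sig card_notin card_sym -expnM.
by rewrite mulnA (mulnC m) => /half_lt_expn.
Qed.

End OneTimePad.

(** * Rate bound from secrecy *)

Section Eavesdropping.
Variables (c : code R C m N) (A B : {set 'I_C}).
Hypothesis cok : code_ok c.
Let Off := {i : 'I_C | i \notin A :|: B}.

Definition passive_adv : adversary C m := Adv A B set0 (fun _ _ _ => 0).

Lemma passive_run msg s t i :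
  (run (c := c) passive_adv msg s N).2 t i =
  (run (c := c) passive_adv msg s N).1 t i.
Proof.
have [tN|Nt] := ltnP t N; last first.
  by have [-> ->] := run_out passive_adv msg s i Nt.
have ja : jam_causal passive_adv by [].
have [_ ->] := run_exec msg s cok ja i tN.
by rewrite /err /=; case: ifP; rewrite addr0.
Qed.

Definition glue (o : {ffun 'I_N * 'I_C -> sym m})
    (w : {ffun 'I_N * Off -> sym m}) : hist C m := fun t i =>
  if insub t is Some t' then
    if insub i is Some i' then w (t', i') else o (t', i)
  else 0.

Lemma glue_run msg s : exists w,
  (run (c := c) passive_adv msg s N).2 = glue (obs passive_adv msg s) w.
Proof.
exists [ffun p => (run passive_adv msg s N).2 (p.1 : 'I_N) (val p.2)].
apply: funext => t; apply: funext => i; rewrite /glue.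
case: insubP => [t' tN <-|]; last first.
  by rewrite -leqNgt => Nt; have [_ ->] := run_out passive_adv msg s i Nt.
case: insubP => [i' iZ <-|]; first by rewrite !ffunE.
by rewrite negbK !ffunE /Zr /= => ->; rewrite passive_run.
Qed.

(** By secrecy, the weight of a message with an observation is the same for all messages. An
    observation completed by words on the unread links decodes to one message, so success is at most
    the number of completions over the number of messages. *)
Lemma eavesdrop_bound :
    1 / 2 < psucc c passive_adv -> mutinf c passive_adv = 0 ->
  (kbits c <= N * m * (C - #|A :|: B|))%N.
Proof.
move=> succ /(mutinf_eq0P _ cok) indep.
pose W := {ffun 'I_N * Off -> sym m}; pose P := {ffun 'I_N * 'I_C -> sym m}.
have [rd0 [rd1 _]] := cok.
have up : psucc c passive_adv <= #|W|%:R * msg_prob c.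
  (* All completions [w] are summed, the true one given by [glue_run] among them; the surplus is
     nonnegative. *)
  apply: (@le_trans _ _ (\sum_(msg : (kbits c).-tuple bool) \sum_(s : rnd c)
     \sum_(o : P) \sum_(w : W) (dec c (glue o w) == msg)%:R *
       (msg_prob c * rdist s * (obs passive_adv msg s == o)%:R))).
    apply: ler_sum => msg _; apply: ler_sum => s _.
    have pos : 0 <= msg_prob c * rdist s.
      by apply: mulr_ge0; [exact/ltW/msg_prob_gt0 | exact: rd0].
    have nn (b b' : nat) : 0 <= b%:R * (msg_prob c * rdist s * b'%:R).
      by apply: mulr_ge0; [exact: ler0n | apply: mulr_ge0].
    have [w wE] := glue_run msg s.
    rewrite (bigD1 (obs passive_adv msg s)) //= (bigD1 w) //= eqxx mulr1.
    rewrite /success wE mulrC -addrA lerDl addr_ge0 //; last first.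
      by apply: sumr_ge0 => o _; apply: sumr_ge0 => w' _; apply: nn.
    by apply: sumr_ge0 => w' _; rewrite mulr_ge0 ?ler0n.
  under eq_bigr => msg _.
    rewrite exchange_big /=; under eq_bigr => o _.
      rewrite exchange_big /=; under eq_bigr => w _ do rewrite -mulr_sumr.
      over.
    over.
  rewrite exchange_big /=.
  have -> : #|W|%:R * msg_prob c = \sum_(o : P) \sum_(w : W)
      (msg_prob c * pobs c passive_adv o).
    under eq_bigr => o _ do rewrite sumr_const -[_ *+ _]mulr_natl mulrA.
    rewrite -mulr_sumr; suff -> : \sum_o pobs c passive_adv o = 1.
      by rewrite mulr1.
    rewrite /pobs exchange_big /= -[RHS](sum_msg_prob c); apply: eq_bigr => msg _.
    rewrite exchange_big /= -[RHS]mulr1 -[X in _ * X]rd1 mulr_sumr.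
    apply: eq_bigr => s _; rewrite -mulr_sumr (bigD1 (obs passive_adv msg s)) //=.
    by rewrite eqxx big1 ?addr0 ?mulr1 // => o; rewrite eq_sym => /negbTE ->.
  apply: ler_sum => o _; rewrite exchange_big /=; apply: ler_sum => w _.
  rewrite (bigD1 (dec c (glue o w))) //= eqxx mul1r [X in _ + X]big1 => [|msg ne];
    last first.
    by rewrite eq_sym (negbTE ne) mul0r.
  by rewrite addr0 -/(pjoint passive_adv _ o) indep.
have := lt_le_trans succ up; rewrite [ltRHS]mulrC.
rewrite card_ffun card_prod card_ord card_sig card_notin card_sym -expnM.
by rewrite mulnA (mulnC m) => /half_lt_expn.
Qed.

End Eavesdropping.
End Converse.

Lemma card_ord_lt (C k : nat) : (k <= C)%N -> #|[set i : 'I_C | (i < k)%N]| = k.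
Proof.
move=> kC; rewrite -sum1dep_card -(big_ord_widen C (fun=> 1%N) kC).
by rewrite sum1_card card_ord.
Qed.

Lemma achievable_le (R : realType) (C zrw zro zwo : nat) (Rt : R) :
    (zrw + zro + zwo <= C)%N -> achievable C zrw zro zwo Rt ->
  Rt <= (C - (zrw + zro))%:R /\ Rt <= (C - (zrw + zwo))%:R.
Proof.
move=> hC /(_ (1 / 2)) []; first by lra.
move=> N0 /(_ N0.+1 (leqnSn _)) [m [m0 [c [cok [rate adv]]]]].
have fin k : (kbits c <= N0.+1 * m * k)%N -> Rt <= k%:R.
  rewrite -(ler_nat R) natrM => /(le_trans rate); rewrite [leRHS]mulrC.
  by rewrite ler_pM2r // ltr0n muln_gt0.
have half a : adv_ok zrw zro zwo a -> 1 / 2 < psucc c a.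
  by move=> /adv [+ _]; rewrite perr_psucc //; lra.
(* The first [zrw] links play [Z_rw]; the links just after them play [Z_ro] or [Z_wo]. *)
pose A := [set i : 'I_C | (i < zrw)%N].
pose seg k := [set i : 'I_C | (zrw <= i < zrw + k)%N].
have AD k : [disjoint A & seg k].
  by rewrite disjoints_subset; apply/subsetP => i; rewrite !inE => ?; lia.
have cA : #|A| = zrw by rewrite card_ord_lt //; lia.
have cU k : (zrw + k <= C)%N -> #|A :|: seg k| = (zrw + k)%N.
  move=> kC; rewrite -(card_ord_lt kC); apply: eq_card => i; rewrite !inE; lia.
have cS k : (zrw + k <= C)%N -> #|seg k| = k.
  move=> kC; have := cU k kC; rewrite cardsU disjoint_setI0 // cards0; lia.
have d0 (S : {set 'I_C}) : [disjoint S & set0] by rewrite -setI_eq0 setI0.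
split; apply: fin.
  rewrite -(cU zro); last lia.
  have ok : adv_ok zrw zro zwo (passive_adv m A (seg zro)).
    by do ?split; rewrite //= ?d0 ?AD ?cA ?cS ?cards0 //; lia.
  by apply: eavesdrop_bound => //; [apply: half | case: (adv _ ok)].
rewrite -(cU zwo); last lia.
apply: pad_bound => // e; apply: half.
do ?split; rewrite //= ?[[disjoint set0 & _]]disjoint_sym ?d0 ?AD //.
- by rewrite cA.
- by rewrite cards0.
- by rewrite cS //; lia.
exact: pad_causal.
Qed.

(** * MDS parity checks *)

Lemma eq_card_bij (S T : finType) : #|S| = #|T| ->
  {f : S -> T & {g | cancel f g & cancel g f}}.
Proof.
move=> e; exists (fun x => enum_val (cast_ord e (enum_rank x))).
exists (fun y => enum_val (cast_ord (esym e) (enum_rank y))) => x.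
  by rewrite enum_valK cast_ordK enum_rankK.
by rewrite enum_valK cast_ordKV enum_rankK.
Qed.

(* Pair d with a polynomial vanishing at x k for every k != i outside A. *)
Lemma power_sums_eq0 (L : fieldType) (I : finType) (D : nat) (x d : I -> L)
    (A : {set I}) : injective x -> (#|~: A| <= D)%N ->
    (forall i, i \in A -> d i = 0) ->
    (forall j, (j < D)%N -> \sum_i d i * x i ^+ j = 0) ->
  forall i, d i = 0.
Proof.
move=> xinj cA dA ps i; have [/dA //|iA] := boolP (i \in A).
pose p := \prod_(k in ~: A :\ i) ('X - (x k)%:P).
have szp : (size p <= D)%N.
  rewrite /p -big_enum size_prod_XsubC -cardE; apply: leq_trans cA.
  by rewrite [X in (_ <= X)%N](cardsD1 i) !inE iA.
have dp : \sum_k d k * p.[x k] = 0.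
  under eq_bigr => k _ do rewrite (horner_coef_wide _ szp) mulr_sumr.
  rewrite exchange_big big1 //= => j _.
  under eq_bigr => k _ do rewrite mulrCA.
  by rewrite -mulr_sumr ps ?mulr0.
have px k : k != i -> d k * p.[x k] = 0.
  move=> ki; have [/dA ->|kA] := boolP (k \in A); first by rewrite mul0r.
  rewrite horner_prod (bigD1 k) ?inE ?ki ?kA //= hornerXsubC subrr mul0r.
  by rewrite mulr0.
move: dp; rewrite (bigD1 i) //= big1 // addr0 => /eqP; rewrite mulf_eq0.
case/orP=> [/eqP //|]; rewrite horner_prod => /prodf_eq0 [k].
rewrite !inE hornerXsubC subr_eq0 => /andP[ki _] /eqP /xinj ik.
by rewrite ik eqxx in ki.
Qed.

(** Any [C - D] coordinates form an information set of every fibre of [H], not only of one code. *)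
Definition mds (V : finType) (C D : nat)
    (H : {ffun 'I_C -> V} -> {ffun 'I_D -> V}) :=
  forall (A : {set 'I_C}), (#|A| + D = C)%N ->
  forall (v : 'I_C -> V) W, exists c : {ffun 'I_C -> V},
    [/\ forall i, i \in A -> c i = v i, H c = W
      & forall c' : {ffun 'I_C -> V},
          (forall i, i \in A -> c' i = v i) -> H c' = W -> c' = c].

(** Reed-Solomon checks: power sums at distinct points of the field with [2 ^ m] elements.
    [power_sums_eq0] gives injectivity, and equal cardinalities give existence. *)
Lemma mds_exists (C D m : nat) : (0 < m)%N -> (D <= C)%N -> (C <= 2 ^ m)%N ->
  exists H : {ffun 'I_C -> sym m} -> {ffun 'I_D -> sym m}, mds H.
Proof.
move=> m0 DC Cm; have [L _ cL] := pPrimePowerField (isT : prime 2) m0.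
(* Any bijection between symbols and field elements will do, since [mds] involves no addition of
   symbols. *)
have [|g [h gK hK]] := @eq_card_bij (sym m) L; first by rewrite card_sym.
have CL : (C <= #|L|)%N by rewrite cL.
pose x (i : 'I_C) : L := enum_val (widen_ord CL i).
have xinj : injective x by move=> i j /enum_val_inj /(congr1 val) /= /val_inj.
pose H (c : {ffun 'I_C -> sym m}) : {ffun 'I_D -> sym m} :=
  [ffun j : 'I_D => h (\sum_i g (c i) * x i ^+ j)].
exists H => A cA.
have cA' : (#|~: A| <= D)%N by have := cardsC A; rewrite card_ord; lia.
have Hinj (c c' : {ffun 'I_C -> sym m}) :
    (forall i, i \in A -> c i = c' i) -> H c = H c' -> c = c'.
  move=> eA /ffunP eH; apply/ffunP => i; apply: (can_inj gK); apply/eqP.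
  rewrite -subr_eq0; apply/eqP.
  apply: (power_sums_eq0 (d := fun i => g (c i) - g (c' i)) xinj cA').
    by move=> k kA; rewrite eA // subrr.
  move=> j jD; have := eH (Ordinal jD); rewrite !ffunE => /(can_inj hK) /= e.
  under eq_bigr => k _ do rewrite mulrBl.
  by rewrite sumrB e subrr.
pose F (c : {ffun 'I_C -> sym m}) :=
  ([ffun i : {i | i \in A} => c (val i)], H c).
have Finj : injective F.
  move=> c c' [/ffunP eA]; apply: Hinj => i iA.
  by have := eA (Sub i iA); rewrite !ffunE.
have [|G _ FG] := inj_card_bij Finj.
  rewrite card_prod !card_ffun !card_ord card_sig -expnD.
  by rewrite (_ : #|_| = #|A|) ?cA //; apply: eq_card => i; rewrite inE.
move=> v W; have := FG ([ffun i : {i | i \in A} => v (val i)], W).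
move: (G _) => c [/ffunP eA eW]; exists c; split=> //.
  by move=> i iA; have := eA (Sub i iA); rewrite !ffunE.
move=> c' eA' eW'; apply: Hinj; last by rewrite eW'.
by move=> i iA; rewrite eA' //; have := eA (Sub i iA); rewrite !ffunE.
Qed.

Section Completion.
Variables (C D : nat).

Lemma subset_of_card (T : finType) (J : {set T}) k : (#|J| <= k <= #|T|)%N ->
  exists2 A : {set T}, J \subset A & #|A| = k.
Proof.
move=> /andP[Jk kT]; pose s := take (k - #|J|) (enum (~: J)).
have sJ i : i \in s -> i \notin J by move/mem_take; rewrite mem_enum inE.
have cJ := cardsC J.
have cs : #|[set i in s]| = (k - #|J|)%N.
  rewrite cardsE (card_uniqP _) ?take_uniq ?enum_uniq // size_takel //.
  by rewrite -cardE; lia.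
exists (J :|: [set i in s]); first exact: subsetUl.
rewrite cardsU disjoint_setI0 ?cards0 ?cs; first lia.
by rewrite disjoint_sym disjoints_subset; apply/subsetP => i; rewrite !inE; apply: sJ.
Qed.

(** A definite choice, so that encoder and analysis share the same set. The default [J] never occurs
    under the hypothesis of [completionP]. *)
Definition completion (J : {set 'I_C}) : {set 'I_C} :=
  odflt J [pick A : {set 'I_C} | (J \subset A) && (#|A| + D == C)%N].

Lemma completionP (J : {set 'I_C}) : (#|J| + D <= C)%N ->
  J \subset completion J /\ (#|completion J| + D = C)%N.
Proof.
move=> JD; rewrite /completion; case: pickP => [A /andP[JA /eqP //]|none].
have [|A JA cA] := @subset_of_card _ J (C - D); first by rewrite card_ord; lia.
by have := none A; rewrite JA cA /= => /eqP; lia.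
Qed.

Variables (V : finType) (H : {ffun 'I_C -> V} -> {ffun 'I_D -> V}).
Hypothesis mdsH : mds H.

Definition solve (A : {set 'I_C}) (v : {ffun 'I_C -> V}) (w : {ffun 'I_D -> V}) :=
  odflt v [pick c : {ffun 'I_C -> V} |
            [forall (i | i \in A), c i == v i] && (H c == w)].

Lemma solveP (A : {set 'I_C}) v w : (#|A| + D = C)%N ->
  (forall i, i \in A -> solve A v w i = v i) /\ H (solve A v w) = w.
Proof.
move=> cA; rewrite /solve; case: pickP => [c /andP[/forall_inP cv /eqP //]|none].
  by split=> // i /cv /eqP.
have [c [cv cH _]] := mdsH cA v w; have := none c; rewrite cH eqxx andbT.
by move/forall_inP; case=> i iA; apply/eqP/cv.
Qed.

Lemma solve_uniq (A : {set 'I_C}) (v : {ffun 'I_C -> V}) w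
    (c : {ffun 'I_C -> V}) : (#|A| + D = C)%N ->
  (forall i, i \in A -> c i = v i) -> H c = w -> solve A v w = c.
Proof.
move=> cA cv codeword; have [sv sw] := solveP v w cA.
have [c0 [_ _ u]] := mdsH cA v w.
by rewrite (u _ cv codeword) (u _ sv sw).
Qed.

End Completion.

(** * The coding scheme *)

Section Scheme.
Variables (R : realType) (C D n m k : nat).
Let V := sym m.
Variables (H : {ffun 'I_C -> V} -> {ffun 'I_D -> V}).
Variables (W : k.-tuple bool -> nat -> {ffun 'I_D -> V}).
Variables (psi : (nat -> {ffun 'I_D -> V}) -> k.-tuple bool).

(* Time 0: noise, the first key of links burnt later; 1..n: data; the next C
   times: noise for the C passwords; the next 2C: report on the first jammings;
   pw: passwords. *)
Definition pw := (n.+1 + 3 * C)%N.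
Definition blocklen := pw.+1.
Let N := blocklen.

Implicit Types (x y : hist C m) (a : adversary C m).
Implicit Types (msg : k.-tuple bool) (r : {ffun 'I_N * 'I_C -> V}).

(** The times examined are 1 to [t - 1]: jamming at time 0 does not burn a link, and jamming at [t]
    has not been seen yet. *)
Definition jammed x y t i := has (fun u => y u i != x u i) (iota 1 t.-1).
Definition jamset x y t := [set i | jammed x y t i].
(* The symbol received when link i is first jammed is not used as a key: it
   already carries a coordinate of a data word. Time 0 stands in for it. *)
Definition key x y t i := if jammed x y t.-1 i then y t.-1 i else y 0 i.
Definition codeword x y t : {ffun 'I_C -> V} :=
  [ffun i => if jammed x y t i then key x y t i else x t i].

(* The value n.+1 means that link i is not jammed during the data times. *)
Definition firstjam x y i := (find (fun u => (y u i != x u i)) (iota 1 n)).+1.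
Definition firsterr x y i : V :=
  let u := firstjam x y i in y u i - x u i.

(** The same report goes out on every link. A time of first jamming is encoded as the symbol of that
    rank in the enumeration of the alphabet. *)
Definition report x y (t : nat) : V :=
  let j := (t - (n.+1 + C))%N in
  if insub j is Some i then nth 0 (enum {: V}) (firstjam x y i)
  else if insub (j - C)%N is Some i then firsterr x y i else 0.
Definition reported x y l :=
  all (fun u => y u l == x u l) (iota (n.+1 + C) (2 * C)).
Definition password y (l : 'I_C) : V := \sum_j y (n.+1 + l)%N j.

(** At data times burnt links send noise but enter the parity checks through their keys; the links
    outside [A] absorb the [D] constraints. *)
Definition step msg r t x y i : V :=
  if t == 0 then r (inord t, i)
  else if (t <= n)%N then
    let A := completion D (jamset x y t) in
    if i \in A then r (inord t, i)
    else solve H A [ffun j => if jammed x y t j then key x y t j else r (inord t, j)]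
           (W msg t) i
  else if (t < n.+1 + C)%N then r (inord t, i)
  else if (t < pw)%N then report x y t
  else if reported x y i then password y i else 0.

Fixpoint sent msg r y t : hist C m :=
  if t is u.+1 then upd (sent msg r y u) u (step msg r u (sent msg r y u) y)
  else fun _ _ => 0.

(** Bob's reconstruction of [codeword] from the report heard on link [l]. The four cases are: before
    the first jamming, at it, just after it (key from time 0), and later (key from the previous
    time). *)
Definition estimate y (l : 'I_C) t : {ffun 'I_C -> V} := [ffun i : 'I_C =>
  let u := index (y (n.+1 + C + i)%N l) (enum {: V}) in
  if (t < u)%N then y t i
  else if t == u then y t i - y (n.+1 + C + (C + i))%N l
  else if t == u.+1 then y 0 i else y t.-1 i].

Definition decode y : k.-tuple bool :=
  if [pick l : 'I_C | y pw l == password y l] is Some l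
  then psi (fun t => H (estimate y l t)) else [tuple of nseq k false].

(** Rounds have length 1, whence [id]. The encoder is given only Bob's words, so Alice recomputes
    her own with [sent]. *)
Definition scheme : code R C m N :=
  Code N (fun _ : {ffun 'I_N * 'I_C -> V} => (#|{ffun 'I_N * 'I_C -> V}|%:R)^-1)
    id (fun t i msg r y => step msg r t (sent msg r y t) y i) decode.

Hypothesis C0 : (0 < C)%N.
Hypothesis mdsH : mds H.

(** * Causality of the scheme *)

Section Causality.
Variables (x y x' y' : hist C m) (t : nat).
Hypothesis ex : forall u j, (u < t)%N -> x u j = x' u j.
Hypothesis ey : forall u j, (u < t)%N -> y u j = y' u j.

Lemma jammed_causal s i : (s <= t)%N -> jammed x y s i = jammed x' y' s i.
Proof.
move=> st; apply: eq_in_has => u; rewrite mem_iota => us.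
by rewrite ex ?ey //; lia.
Qed.

Lemma firstjam_causal i : (n < t)%N -> firstjam x y i = firstjam x' y' i.
Proof.
move=> nt; congr _.+1; apply: eq_in_find => u; rewrite mem_iota => us.
by rewrite ex ?ey //; lia.
Qed.

Lemma firstjam_le i : (firstjam x y i <= n.+1)%N.
Proof. by rewrite ltnS -[leqRHS](size_iota 1) find_size. Qed.

Lemma step_causal msg r i : step msg r t x y i = step msg r t x' y' i.
Proof.
rewrite /step; case: eqP => // t0.
have -> : jamset x y t = jamset x' y' t.
  by apply/setP => j; rewrite !inE jammed_causal.
have -> : [ffun j => if jammed x y t j then key x y t j else r (inord t, j)] =
          [ffun j => if jammed x' y' t j then key x' y' t j else r (inord t, j)].
  apply/ffunP => j; rewrite !ffunE /key !jammed_causal ?leq_pred //.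
  by rewrite !ey //; lia.
case: (leqP t n) => // nt; case: (ltnP t (n.+1 + C)) => // nCt.
have eF : firstjam x y =1 firstjam x' y' by move=> j; apply: firstjam_causal.
case: (ltnP t pw) => tpw.
  rewrite /report; case: insubP => [j _ _|_]; first by rewrite eF.
  case: insubP => // j _ _; rewrite /firsterr -eF.
  by have := firstjam_le j => ?; rewrite ex ?ey //; lia.
rewrite /reported (@eq_in_all _ _ (fun u => y' u i == x' u i)); last first.
  by move=> u; rewrite mem_iota /pw in tpw * => ?; rewrite ex ?ey //; lia.
case: all => //; apply: eq_bigr => j _; rewrite ey //.
move: tpw; rewrite /pw => tpw; have := ltn_ord i; lia.
Qed.

End Causality.

Lemma sentE msg r y t u i : (u < t)%N ->
  sent msg r y t u i = step msg r u (sent msg r y u) y i.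
Proof.
elim: t => // t IH; rewrite ltnS leq_eqVlt /= /upd.
by case/predU1P=> [->|ut]; [rewrite eqxx | rewrite (ltn_eqF ut) IH].
Qed.

Lemma sent_causal msg r y y' t : (forall u j, (u < t)%N -> y u j = y' u j) ->
  forall u i, (u < t)%N -> sent msg r y t u i = sent msg r y' t u i.
Proof.
elim/ltn_ind: t => t IH ey u i ut; rewrite !sentE //; apply: step_causal.
  by apply: IH => // v j vu; apply/ey/(ltn_trans vu).
by move=> v j vu; apply/ey/(ltn_trans vu).
Qed.

Lemma card_noise_gt0 : (0 < #|{ffun 'I_N * 'I_C -> V}|)%N.
Proof. by apply/card_gt0P; exists [ffun=> 0]. Qed.

Lemma scheme_ok : code_ok scheme.
Proof.
split; first by move=> s; rewrite /= invr_ge0 ler0n.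
split.
  rewrite /= sumr_const -[LHS]mulr_natl mulfV // pnatr_eq0 -lt0n.
  exact: card_noise_gt0.
split; first by split=> //; split=> [t _|t _] //; left.
move=> t i msg r y y' ey /=; apply: step_causal => // u j ut.
by apply: sent_causal => //; apply: ey.
Qed.

Definition stepexec a msg r x y := forall t i, (t < N)%N ->
  x t i = step msg r t x y i /\ y t i = x t i + err a x t i.

(** Replaces the recomputed history [sent] by the actual one, so that later arguments can alter [x]
    and [y] directly. *)
Lemma stepexecP a msg r x y :
  exec (c := scheme) a msg r x y <-> stepexec a msg r x y.
Proof.
split=> e t i tN; have [ex ey] := e t i tN; split=> //; rewrite ex /=.
  apply: step_causal => // u j ut; rewrite sentE //.
  by have [-> _] := e u j (ltn_trans ut tN).
apply: step_causal => // {ex ey i}.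
elim/ltn_ind: t tN => t IH tN u j ut; have uN := ltn_trans ut tN.
rewrite sentE //; have [-> _] := e u j uN; apply: step_causal => // v l vu.
by rewrite -(IH u).
Qed.

(** Turns the recipe [solve] into two conditions, noise on the completion and the parity checks,
    which can be verified on a modified transmission. The converse direction rests on
    [solve_uniq]. *)
Lemma step_dataP msg r x y t : (0 < t <= n)%N -> (#|jamset x y t| + D <= C)%N ->
  (forall i, x t i = step msg r t x y i) <->
  (forall i, i \in completion D (jamset x y t) -> x t i = r (inord t, i)) /\
  H (codeword x y t) = W msg t.
Proof.
move=> /andP[t0 tn] cJ; have [JA cA] := completionP cJ.
have stepE i : step msg r t x y i =
    if i \in completion D (jamset x y t) then r (inord t, i)
    else solve H (completion D (jamset x y t))
      [ffun j => if jammed x y t j then key x y t j else r (inord t, j)]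
           (W msg t) i.
  by rewrite /step gtn_eqF // tn.
set A := completion D _ in JA cA stepE *; set v := [ffun j => _] in stepE.
have [sv sH] := solveP mdsH v (W msg t) cA.
split=> [ex|[exA exH] i].
  have xA i : i \in A -> x t i = r (inord t, i) by move=> iA; rewrite ex stepE iA.
  split=> //; rewrite -[RHS]sH; congr (H _); apply/ffunP => i; rewrite ffunE.
  have [iA|iA] := boolP (i \in A); first by rewrite sv // ffunE xA.
  have -> : jammed x y t i = false.
    by apply: contraNF iA => ij; rewrite (subsetP JA) // inE.
  by rewrite ex stepE (negbTE iA).
rewrite stepE; case: ifP => [/exA //|/negbT iA].
rewrite (solve_uniq mdsH cA (c := codeword x y t)) // ?ffunE.
  have -> // : jammed x y t i = false.
  by apply: contraNF iA => ij; rewrite (subsetP JA) // inE.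
by move=> j jA; rewrite !ffunE exA.
Qed.

Lemma step_noise msg r x y t i : (t == 0) || (n < t < n.+1 + C)%N ->
  step msg r t x y i = r (inord t, i).
Proof.
case/orP=> [/eqP -> //|/andP[nt tC]].
by rewrite /step gtn_eqF ?(leq_ltn_trans _ nt) // leqNgt nt /= tC.
Qed.

Lemma step_late msg msg' r r' x y t i : (n.+1 + C <= t)%N ->
  step msg r t x y i = step msg' r' t x y i.
Proof.
move=> tC; rewrite /step; have [-> -> ->] : [/\ (t == 0) = false, (t <= n)%N = false &
  (t < n.+1 + C)%N = false] by split; lia.
by [].
Qed.

Lemma jammedE x y t i : (t <= n.+1)%N -> jammed x y t i = (firstjam x y i < t)%N.
Proof.
move=> tn; rewrite /jammed /firstjam.
have -> : iota 1 t.-1 = take t.-1 (iota 1 n).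
  by rewrite take_iota (minn_idPl _) //; lia.
by rewrite has_take_leq ?size_iota; lia.
Qed.

Lemma before_firstjam x y t i : (0 < t < firstjam x y i)%N -> y t i = x t i.
Proof.
move=> /andP[t0 tf]; have := firstjam_le x y i => fn.
have lt : (t.-1 < find (fun u => y u i != x u i) (iota 1 n))%N.
  by move: tf; rewrite /firstjam; lia.
have := before_find 0 lt; rewrite nth_iota; last by rewrite /firstjam in fn; lia.
by rewrite add1n prednK // => /negbFE /eqP.
Qed.

Lemma jamset_sub a msg r x y t : stepexec a msg r x y -> (t <= n.+1)%N ->
  jamset x y t \subset Zw a.
Proof.
move=> e tn; apply/subsetP => i; rewrite inE => /hasP [u].
rewrite mem_iota => ut; have [|_ ->] := e u i.
  by rewrite /N /blocklen /pw; lia.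
by rewrite /err; case: ifP => //; rewrite addr0 eqxx.
Qed.

Lemma jamset_card a msg r x y t : stepexec a msg r x y -> (t <= n.+1)%N ->
  (#|Zw a| + D <= C)%N -> (#|jamset x y t| + D <= C)%N.
Proof.
move=> e tn; apply: leq_trans; rewrite leq_add2r.
exact: subset_leq_card (jamset_sub e tn).
Qed.

Lemma stepexec_codeword a msg r x y t : stepexec a msg r x y ->
    (#|Zw a| + D <= C)%N -> (0 < t <= n)%N ->
  (forall i, i \in completion D (jamset x y t) -> x t i = r (inord t, i)) /\
  H (codeword x y t) = W msg t.
Proof.
move=> e wD tn; apply/(step_dataP _ _ tn).
  by apply: jamset_card e _ wD; lia.
by move=> i; have [] := e t i; rewrite // /N /blocklen /pw; lia.
Qed.

(** * Transmissions with the same errors *)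

Section SameErrors.
Variables x y x' y' : hist C m.
Hypothesis diff : forall u j, y' u j - x' u j = y u j - x u j.

Lemma neq_diff u j : (y' u j == x' u j) = (y u j == x u j).
Proof. by rewrite -subr_eq0 diff subr_eq0. Qed.

Lemma jammed_diff t i : jammed x' y' t i = jammed x y t i.
Proof. by apply: eq_has => u; rewrite neq_diff. Qed.

Lemma jamset_diff t : jamset x' y' t = jamset x y t.
Proof. by apply/setP => i; rewrite !inE jammed_diff. Qed.

Lemma firstjam_diff i : firstjam x' y' i = firstjam x y i.
Proof. by congr _.+1; apply: eq_find => u; rewrite neq_diff. Qed.

Lemma reported_diff l : reported x' y' l = reported x y l.
Proof. by apply: eq_all => u; rewrite neq_diff. Qed.

(** Reports depend on the errors alone, so equal errors leave only the passwords to compare, and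
    only those that Alice releases. *)
Lemma step_late_diff msg msg' r r' t i : (n.+1 + C <= t)%N ->
    (reported x y i -> password y' i = password y i) ->
  step msg' r' t x' y' i = step msg r t x y i.
Proof.
move=> tC ep; rewrite (step_late msg' msg r' r) // /step.
have [-> -> ->] : [/\ (t == 0) = false, (t <= n)%N = false &
  (t < n.+1 + C)%N = false] by split; lia.
rewrite reported_diff; case: (t < pw)%N; last by case: ifP.
rewrite /report; case: insubP => [j _ _|_]; first by rewrite firstjam_diff.
by case: insubP => // j _ _; rewrite /firsterr firstjam_diff diff.
Qed.

End SameErrors.

(** * Secrecy of the scheme *)

Section Swap.
Variable B : {set 'I_C}.
Hypothesis cB : (#|B| + D = C)%N.

(* [swap msg] rewrites a transmission into one of [msg] that has the same errors
   and the same symbols on B, i.e. looks the same to Calvin when he reads B. *)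
Definition swapword msg x y t := solve H B (codeword x y t) (W msg t).

(** A symbol received on a burnt link is the key of the next time, so the new word at [t.+1]
    dictates it, and removing the error gives the sent symbol. Time 0 is treated likewise for the
    time after the first jamming. *)
Definition swap msg x y : hist C m := fun t i =>
  if t == 0 then
    let u := (firstjam x y i).+1 in
    if (u <= n)%N then swapword msg x y u i - (y 0 i - x 0 i) else x 0 i
  else if (t <= n)%N then
    if jammed x y t i then
      if (t < n)%N then swapword msg x y t.+1 i - (y t i - x t i) else x t i
    else swapword msg x y t i
  else x t i.

Definition swapy msg x y : hist C m := fun t i => swap msg x y t i + (y t i - x t i).

Lemma swapword_on msg x y t i : i \in B -> swapword msg x y t i = codeword x y t i.
Proof. by have [+ _] := solveP mdsH (codeword x y t) (W msg t) cB; apply. Qed.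

Lemma jammed_first x y i : (firstjam x y i < n)%N ->
  jammed x y (firstjam x y i).+1 i && ~~ jammed x y (firstjam x y i) i.
Proof. by move=> fn; rewrite !jammedE ?ltnn ?ltnSn //; lia. Qed.

Lemma jammedS x y t i : (t <= n)%N -> jammed x y t i -> jammed x y t.+1 i.
Proof. by move=> tn; rewrite !jammedE //; lia. Qed.

Lemma swap_on msg x y t i : i \in B -> swap msg x y t i = x t i.
Proof.
move=> iB; rewrite /swap !swapword_on // !ffunE /key /=.
case: eqP => [->|t0].
  by case: leqP => // /jammed_first /andP[-> /negbTE ->]; rewrite subKr.
case: (leqP t n) => // tn; case: (boolP (jammed x y t i)) => // jt.
by case: (ltnP t n) => // lt; rewrite jammedS // subKr.
Qed.

Lemma swapB msg x y t i : swapy msg x y t i - swap msg x y t i = y t i - x t i.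
Proof. by rewrite /swapy addrAC subrr add0r. Qed.

Lemma swap_jammed msg x y t i :
  jammed (swap msg x y) (swapy msg x y) t i = jammed x y t i.
Proof. by apply: jammed_diff => u j; apply: swapB. Qed.

Lemma swap_firstjam msg x y i :
  firstjam (swap msg x y) (swapy msg x y) i = firstjam x y i.
Proof. by apply: firstjam_diff => u j; apply: swapB. Qed.

Lemma swap_late msg x y t i : (n < t)%N -> swap msg x y t i = x t i.
Proof.
by move=> nt; rewrite /swap ifF ?ifF //; apply/negbTE; lia.
Qed.

Lemma swapy_late msg x y t i : (n < t)%N -> swapy msg x y t i = y t i.
Proof. by move=> nt; rewrite /swapy swap_late // addrC subrK. Qed.

Lemma swap_codeword msg x y t : (0 < t <= n)%N ->
  codeword (swap msg x y) (swapy msg x y) t = swapword msg x y t.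
Proof.
move=> /andP[t0 tn]; apply/ffunP => i; rewrite ffunE /key !swap_jammed.
case: ifP => jt; last by rewrite /swap gtn_eqF // tn jt.
(* On a burnt link the key is the previous received symbol, or that of time 0 when the first jamming
   was at [t - 1]. *)
case: ifP => jp; rewrite /swapy /swap.
  have t1 : (0 < t.-1)%N by case: (t) jp => [|[]].
  by rewrite gtn_eqF // (leq_trans (leq_pred _) tn) jp prednK // ifT ?subrK //; lia.
move: jt jp; rewrite !jammedE; [|lia..] => jt jp /=.
have -> : (firstjam x y i).+1 = t by lia.
by rewrite tn subrK.
Qed.

Lemma swapword_back msg msg' x y t :
    (0 < t <= n)%N -> H (codeword x y t) = W msg t ->
  swapword msg (swap msg' x y) (swapy msg' x y) t = codeword x y t.
Proof.
move=> tn Ht; rewrite /swapword swap_codeword //; apply: solve_uniq => // i iB.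
by rewrite swapword_on.
Qed.

(** The original codeword has the checks of [msg] and was kept on [B], so uniqueness in the MDS
    property recovers it. *)
Lemma swap_back msg msg' x y t i :
    (forall u, (0 < u <= n)%N -> H (codeword x y u) = W msg u) ->
  swap msg (swap msg' x y) (swapy msg' x y) t i = x t i.
Proof.
move=> Hx; rewrite {1}/swap !swapB swap_firstjam swap_jammed /=.
case: eqP => [->|t0].
  case: (ltnP (firstjam x y i) n) => fn; last by rewrite /swap /= ltnNge fn.
  rewrite swapword_back ?Hx // ffunE /key /=.
  by have /andP[-> /negbTE ->] := jammed_first fn; rewrite subKr.
case: (leqP t n) => tn; last by rewrite swap_late.
case: ifP => jt; last by rewrite swapword_back ?Hx ?ffunE ?jt //; lia.
case: (ltnP t n) => lt; last by rewrite /swap (introF eqP t0) tn jt ltnNge lt.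
by rewrite swapword_back ?Hx // ffunE /key /= jt jammedS // subKr.
Qed.

(** The noise with which the scheme sends the swapped transmission. All entries not dictated by it
    are kept, which makes the change reversible. *)
Definition swapr msg x y r : {ffun 'I_N * 'I_C -> V} := [ffun p : 'I_N * 'I_C =>
  let t := p.1 : nat in
  if (t <= n)%N && ((t == 0) || (p.2 \in completion D (jamset x y t)))
  then swap msg x y t p.2 else r p].

Lemma swaprE msg x y r t i : (t < N)%N -> swapr msg x y r (inord t, i) =
  if (t <= n)%N && ((t == 0) || (i \in completion D (jamset x y t)))
  then swap msg x y t i else r (inord t, i).
Proof. by move=> tN; rewrite ffunE /= inordK. Qed.

Lemma swapr_back msg msg' a r x y : stepexec a msg r x y ->
    (#|Zw a| + D <= C)%N ->
  swapr msg (swap msg' x y) (swapy msg' x y) (swapr msg' x y r) = r.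
Proof.
move=> e wD; apply/ffunP => -[t i]; have [u uN ->] : exists2 u, (u < N)%N & t = inord u.
  by exists t; rewrite ?inord_val.
rewrite !swaprE // (jamset_diff (swapB _ _ _)).
case: ifP => [/andP[un uA]|->] //.
rewrite swap_back => [|v vn]; last by have [] := stepexec_codeword e wD vn.
have [/eqP u0|u0] := boolP (u == 0%N).
  by have [-> _] := e u i uN; rewrite step_noise // u0.
have [|+ _] := stepexec_codeword e wD (t := u); first by rewrite lt0n u0.
by apply; rewrite (negbTE u0) in uA.
Qed.

(** Calvin reads only inside [B], where nothing has changed, so he commits the same errors. After
    time [n] nothing changes at all. *)
Lemma swap_exec msg msg' a r x y : jam_causal a -> Zr a \subset B ->
    (#|Zw a| + D <= C)%N -> stepexec a msg r x y ->
  stepexec a msg' (swapr msg' x y r) (swap msg' x y) (swapy msg' x y).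
Proof.
move=> ja rB wD e t i tN; have [ex ey] := e t i tN; split; last first.
  rewrite /swapy ey [x t i + _]addrC addrK; congr (_ + _).
  apply: err_causal => // u j _ jr; rewrite swap_on //.
  exact: (subsetP rB).
have [tn|nt] := leqP t n; last first.
  have nt0 : (t == 0) = false by case: (t) nt.
  rewrite swap_late // ex; have [tC|Ct] := ltnP t (n.+1 + C).
    by rewrite !step_noise ?nt ?tC ?nt0 // swaprE // leqNgt nt.
  apply/esym/step_late_diff => // [u j|_]; first exact: swapB.
  by apply: eq_bigr => j _; rewrite swapy_late //; lia.
case: (posnP t) => [t0|t0].
  by rewrite step_noise ?t0 // swaprE //.
have tn' : (0 < t <= n)%N by rewrite t0.
move: i {ex ey}; apply/(step_dataP _ _ tn').
  rewrite (jamset_diff (swapB _ _ _)); apply: jamset_card e _ wD; lia.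
split; last first.
  by rewrite swap_codeword //; have [_ ->] := solveP mdsH (codeword x y t) (W msg' t) cB.
move=> i; rewrite (jamset_diff (swapB _ _ _)) => iA.
by rewrite swaprE // tn iA orbT.
Qed.

End Swap.

Section Secrecy.
Variable a : adversary C m.
Hypotheses (ja : jam_causal a) (wD : (#|Zw a| + D <= C)%N).
Hypothesis (rD : (#|Zr a| + D <= C)%N).
Let B := completion D (Zr a).

Definition runx msg r := (run (c := scheme) a msg r N).1.
Definition runy msg r := (run (c := scheme) a msg r N).2.

Lemma run_stepexec msg r : stepexec a msg r (runx msg r) (runy msg r).
Proof. by apply/stepexecP; apply: run_exec ja; apply: scheme_ok. Qed.

Lemma stepexec_run msg r x y : stepexec a msg r x y ->
    (forall t i, (N <= t)%N -> x t i = 0 /\ y t i = 0) ->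
  runx msg r = x /\ runy msg r = y.
Proof.
move=> e out; have eq t i : runx msg r t i = x t i /\ runy msg r t i = y t i.
  have [tN|Nt] := ltnP t N; last first.
    by have [-> ->] := out t i Nt; apply: (@run_out R C N m scheme a msg r N t i Nt).
  have e' : exec (c := scheme) a msg r x y by apply/stepexecP.
  have e0 := @run_exec R C N m scheme a msg r scheme_ok ja.
  exact: (@exec_uniq R C N m scheme a msg r _ _ _ _ scheme_ok ja e0 e' t i tN).
by split; apply: funext => t; apply: funext => i; have [] := eq t i.
Qed.

Definition resample msg' msg r := swapr B msg' (runx msg r) (runy msg r) r.

Lemma run_resample msg msg' r :
  runx msg' (resample msg' msg r) = swap B msg' (runx msg r) (runy msg r) /\
  runy msg' (resample msg' msg r) = swapy B msg' (runx msg r) (runy msg r).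
Proof.
have [rB cB] := completionP rD.
apply: stepexec_run => [|t i Nt].
  by apply: (@swap_exec _ cB msg) => //; apply: run_stepexec.
have nt : (n < t)%N by move: Nt; rewrite /N /blocklen /pw; lia.
by rewrite swap_late // swapy_late //; apply: run_out.
Qed.

Lemma resampleK msg msg' : cancel (resample msg' msg) (resample msg msg').
Proof.
have [rB cB] := completionP rD.
move=> r; rewrite {1}/resample; have [-> ->] := run_resample msg msg' r.
exact: swapr_back (run_stepexec msg r) wD.
Qed.

Lemma obs_resample msg msg' r :
  obs (c := scheme) a msg' (resample msg' msg r) = obs (c := scheme) a msg r.
Proof.
have [rB cB] := completionP rD.
apply/ffunP => -[t i]; rewrite !ffunE /=; case: ifP => // iZ.
have [ex _] := run_resample msg msg' r.
rewrite [LHS](congr1 (fun h : hist C m => h (t : nat) i) ex).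
by rewrite swap_on // (subsetP rB).
Qed.

(** For any two messages, [resample] is a bijection of the uniform noise that preserves the
    observation, so the observation has the same law under both. *)
Lemma scheme_secret : mutinf scheme a = 0.
Proof.
apply/(mutinf_eq0P _ scheme_ok) => msg o.
have indep msg' : pjoint (c := scheme) a msg' o = pjoint (c := scheme) a msg o.
  rewrite /pjoint (reindex (resample msg' msg)) /=; last first.
    by exists (resample msg msg') => r _; apply: resampleK.
  by apply: eq_bigr => r _; rewrite obs_resample.
rewrite /pobs; under eq_bigr => msg' _ do rewrite indep.
by rewrite mulr_sumr -mulr_suml sum_msg_prob mul1r.
Qed.

(** * Reliability of the scheme *)

Section Decoding.
Hypotheses (D0 : (0 < D)%N) (nm : (n.+1 < 2 ^ m)%N).
Hypothesis psiW : forall msg g,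
  (forall t, (0 < t <= n)%N -> g t = W msg t) -> psi g = msg.

Lemma step_report msg r x y t i : (n.+1 + C <= t < pw)%N ->
  step msg r t x y i = report x y t.
Proof.
move=> tr; rewrite /step; have [-> -> -> ->] : [/\ (t == 0) = false,
  (t <= n)%N = false, (t < n.+1 + C)%N = false & (t < pw)%N] by split; lia.
by [].
Qed.

Lemma step_pw msg r x y i :
  step msg r pw x y i = if reported x y i then password y i else 0.
Proof.
rewrite /step ltnn; have [-> ->] : (pw <= n)%N = false /\ (pw < n.+1 + C)%N = false.
  by rewrite /pw; split; lia.
by [].
Qed.

Lemma report_firstjam x y (i : 'I_C) :
  report x y (n.+1 + C + i)%N = nth 0 (enum {: V}) (firstjam x y i).
Proof. by rewrite /report addKn valK. Qed.

Lemma report_firsterr x y (i : 'I_C) :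
  report x y (n.+1 + C + (C + i))%N = firsterr x y i.
Proof. by rewrite /report addKn insubF ?addKn ?valK //; apply/negbTE; lia. Qed.

Lemma estimate_codeword x y l t : (0 < t <= n)%N ->
    (forall i : 'I_C, y (n.+1 + C + i)%N l = report x y (n.+1 + C + i)) ->
    (forall i : 'I_C, y (n.+1 + C + (C + i))%N l = report x y (n.+1 + C + (C + i))) ->
  estimate y l t = codeword x y t.
Proof.
move=> /andP[t0 tn] ej ee; apply/ffunP => i; rewrite !ffunE ej ee.
rewrite report_firstjam report_firsterr /key !jammedE; [|lia..].
(* Since [n.+1 < 2 ^ m], the alphabet has a symbol of every rank up to [n.+1], the value for an
   unjammed link included. *)
have fn := firstjam_le x y i; rewrite index_uniq ?enum_uniq //; last first.
  by rewrite -cardE card_sym; apply: leq_ltn_trans nm.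
have [lt|gt|eqf] := ltngtP t (firstjam x y i).
- by rewrite (before_firstjam (x := x)) ?t0.
- have -> : (t == (firstjam x y i).+1) = ~~ (firstjam x y i < t.-1)%N by lia.
  by case: ltnP.
- by rewrite /firsterr -eqf subKr.
Qed.

Definition forged msg r l := let x := runx msg r in let y := runy msg r in
  ~~ reported x y l && (y pw l == password y l).

(** Without forgery, a link that shows its password delivered the whole report intact, so Bob
    recovers every data word. *)
Lemma decode_correct msg r : (forall l, ~~ forged msg r l) ->
  decode (runy msg r) = msg.
Proof.
move=> nf; have e := run_stepexec msg r.
set x := runx msg r in e; set y := runy msg r in e *.
have rep l : reported x y l -> forall t, (n.+1 + C <= t < pw)%N ->
    y t l = report x y t.
  move=> /allP rl t tr; have [|ex _] := e t l; first by rewrite /N /blocklen; lia.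
  rewrite (eqP (rl t _)) ?ex ?step_report //.
  by rewrite mem_iota; move: tr; rewrite /pw; lia.
(* As [D] is positive, Calvin cannot write on every link, and an untouched link always passes the
   password test. *)
have [l0 l0w] : exists l0, l0 \notin Zw a.
  apply/existsP; rewrite -negb_forall; apply/negP => /forallP all.
  have : #|Zw a| = C by rewrite (eq_card (B := 'I_C)) ?card_ord // => i; rewrite all.
  by move: wD; lia.
have clean t : (t < N)%N -> y t l0 = x t l0.
  by move=> /(e t l0) [_ ->]; rewrite /err (negbTE l0w) addr0.
rewrite /decode; case: pickP => [l yl|none]; last first.
  have := none l0; rewrite clean ?ltnSn //.
  have [-> _] := e pw l0 (ltnSn _); rewrite step_pw ifT ?eqxx //.
  apply/allP => u; rewrite mem_iota => ul; apply/eqP/clean.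
  by rewrite /N /blocklen /pw; lia.
have rl : reported x y l by have := nf l; rewrite /forged yl andbT negbK.
apply: psiW => t tn; have [_ <-] := stepexec_codeword e wD tn; congr (H _).
apply: estimate_codeword => // i; apply: rep => //;
  by rewrite /pw; have := ltn_ord i; lia.
Qed.

End Decoding.

(* Changing the noise of the l-th password time on a link j0 that Calvin does not
   read changes the l-th password and nothing else, as long as Alice withholds
   it: exactly one value of that noise makes a given forgery succeed. *)
Section Forgery.
Variable j0 : 'I_C.
Hypothesis j0r : j0 \notin Zr a.

Definition bump (l : 'I_C) (d : V) t i :=
  if (t == (n.+1 + l)%N) && (i == j0) then d else 0.
Definition shift r l d : {ffun 'I_N * 'I_C -> V} :=
  [ffun p : 'I_N * 'I_C => r p + bump l d p.1 p.2].
Definition shifth (h : hist C m) l d : hist C m := fun t i => h t i + bump l d t i.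

Lemma bump0 (l : 'I_C) d (t : nat) i : (t != n.+1 + l)%N -> bump l d t i = 0.
Proof. by rewrite /bump => /negbTE ->. Qed.

Lemma step_noise_ext msg r r' x y t i :
    (forall j, r' (inord t, j) = r (inord t, j)) ->
  step msg r' t x y i = step msg r t x y i.
Proof.
move=> er; rewrite /step er; do ![case: ifP => // _].
by congr (solve H _ _ _ _); apply/ffunP => j; rewrite !ffunE er.
Qed.

Lemma password_shift y l d : password (shifth y l d) l = password y l + d.
Proof.
rewrite /password big_split /=; congr (_ + _).
by rewrite (bigD1 j0) //= /bump !eqxx big1 ?addr0 // => j /negbTE ->; rewrite andbF.
Qed.

Lemma stepexec_shift msg r x y l d : ~~ reported x y l -> stepexec a msg r x y ->
  stepexec a msg (shift r l d) (shifth x l d) (shifth y l d).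
Proof.
move=> nr e t i tN; have [ex ey] := e t i tN; split; last first.
  rewrite /shifth ey addrAC; congr (_ + _); apply: err_causal => // u j _ jr.
  rewrite /bump; case: (j =P j0) => [jj|_]; last by rewrite andbF addr0.
  by rewrite jj (negbTE j0r) in jr.
have er j : shift r l d (inord t, j) = r (inord t, j) + bump l d t j.
  by rewrite ffunE /= inordK.
have [tn|nt] := leqP t n.
  have b0 u j : (u <= t)%N -> bump l d u j = 0 by move=> ut; rewrite bump0 //; lia.
  rewrite (@step_noise_ext msg r) => [|j]; last by rewrite er b0 ?addr0.
  rewrite /shifth b0 // addr0 ex; apply: step_causal => u j ut; rewrite b0 ?addr0 //.
    exact: ltnW.
  exact: ltnW.
have [tC|Ct] := ltnP t (n.+1 + C).
  by rewrite step_noise ?nt ?tC ?orbT // er /shifth ex step_noise // nt tC orbT.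
rewrite /shifth bump0 ?addr0 ?ex; last by have := ltn_ord l; lia.
apply/esym/step_late_diff => // [u j|ri].
  by rewrite opprD addrACA subrr addr0.
(* A released password belongs to a link other than [l], hence sums noise of another time. *)
apply: eq_bigr => j _; rewrite bump0 ?addr0 // eqn_add2l.
by apply: contraNneq nr => /val_inj <-.
Qed.

Lemma run_shift msg r l d : ~~ reported (runx msg r) (runy msg r) l ->
  runx msg (shift r l d) = shifth (runx msg r) l d /\
  runy msg (shift r l d) = shifth (runy msg r) l d.
Proof.
move=> nr; apply: stepexec_run => [|t i Nt].
  exact: stepexec_shift (run_stepexec msg r).
rewrite /shifth bump0 ?addr0; first exact: run_out.
by move: Nt; rewrite /N /blocklen /pw; have := ltn_ord l; lia.
Qed.

(** Shifting is injective on pairs of a forgery and a value [d]: equal shifted words share their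
    last symbol on [l], which is the password before the shift, and comparing shifted passwords
    gives [d]. *)
Lemma forged_card msg l :
  (#|[pred r | forged msg r l]| * 2 ^ m <= #|{ffun 'I_N * 'I_C -> V}|)%N.
Proof.
rewrite -(card_sym m) -cardX.
pose F (u : {ffun 'I_N * 'I_C -> V} * sym m) := shift u.1 l u.2.
apply: (@leq_card_in _ _ F) => -[r d] [r' d'].
rewrite !inE /= => /andP[/andP[nr /eqP yr] _] /andP[/andP[nr' /eqP yr'] _] eF.
have [_ e] := run_shift d nr; have [_ e'] := run_shift d' nr'.
rewrite /F /= in eF; rewrite -eF e in e'.
have pwE h c : shifth h l c pw l = h pw l.
  by rewrite /shifth bump0 ?addr0 // /pw; have := ltn_ord l; lia.
have := congr1 (fun h : hist C m => h pw l) e'; rewrite !pwE yr yr' => ep.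
have := congr1 (fun h : hist C m => password h l) e'; rewrite !password_shift ep.
move=> /addrI ed; rewrite -ed in eF *; congr (_, _); apply/ffunP => p.
by have /ffunP/(_ p) := eF; rewrite !ffunE => /addIr.
Qed.

End Forgery.

(** A union bound over the [C] links on which a forgery may occur. *)
Lemma scheme_reliable : (0 < D)%N -> (n.+1 < 2 ^ m)%N ->
    (forall msg g, (forall t, (0 < t <= n)%N -> g t = W msg t) -> psi g = msg) ->
  perr scheme a <= C%:R / (2 ^ m)%:R.
Proof.
move=> D0 nm psiW.
have [j0 j0r] : exists j0, j0 \notin Zr a.
  apply/existsP; rewrite -negb_forall; apply/negP => /forallP all.
  have : #|Zr a| = C by rewrite (eq_card (B := 'I_C)) ?card_ord // => i; rewrite all.
  by move: rD; lia.
rewrite -[leRHS]mul1r -[X in X * _](sum_msg_prob scheme) mulr_suml.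
apply: ler_sum => msg _.
have termE (r : rnd scheme) : msg_prob scheme * rdist r *
    (dec scheme (run a msg r N).2 != msg)%:R =
    msg_prob scheme * ((#|{ffun 'I_N * 'I_C -> V}|%:R)^-1 *
    (decode (runy msg r) != msg)%:R) by rewrite -mulrA.
rewrite (eq_bigr _ (fun r _ => termE r)) -mulr_sumr.
rewrite ler_wpM2l ?(ltW (msg_prob_gt0 _)) // -mulr_sumr.
rewrite ler_pdivrMl ?ltr0n ?card_noise_gt0 // mulrA ler_pdivlMr ?ltr0n ?expn_gt0 //.
rewrite -natr_sum -!natrM ler_nat.
apply: (@leq_trans (\sum_l #|[pred r | forged msg r l]| * 2 ^ m)).
  rewrite -big_distrl leq_mul2r; apply/orP; right.
  rewrite (eq_bigr (fun l => \sum_r (forged msg r l : nat)))%N; last first.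
    by move=> l _; rewrite sum_bool_card.
  rewrite exchange_big /=; apply: leq_sum => r _.
  have [nf|] := boolP [forall l, ~~ forged msg r l].
    by rewrite decode_correct ?eqxx // => l; apply: (forallP nf).
  rewrite negb_forall => /existsP[l]; rewrite negbK => fl.
  by rewrite (bigD1 l) //= fl; case: (_ != _).
apply: (@leq_trans (\sum_(l < C) #|{ffun 'I_N * 'I_C -> V}|)).
  by apply: leq_sum => l _; apply: forged_card j0r _ _.
by rewrite sum_nat_const card_ord mulnC.
Qed.

End Secrecy.
End Scheme.

(** * Capacity *)

(** Covers [D = 0]: with zero bits there is a single message, which can be neither mistaken nor
    leaked. *)
Lemma achievable_zero (R : realType) (C zrw zro zwo : nat) :
  achievable C zrw zro zwo (0 : R).
Proof.
move=> eps eps0; exists 0%N => N _; exists 1%N; split=> //.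
pose c : code R C 1 N := @Code R C 1 N 0 unit (fun=> 1) id (fun _ _ _ _ _ => 0)
  (fun _ => [tuple]).
have cok : code_ok c.
  split; first by move=> s; apply: ler01.
  split; first by rewrite big_const card_unit /= addr0.
  by split=> //; split=> //; split=> // t _; left.
exists c; split=> //; rewrite mul0r ler0n; split=> // a _; split.
  rewrite /perr big1 // => msg _; rewrite big1 // => s _.
  by rewrite (tuple0 (dec c _)) (tuple0 msg) eqxx mulr0.
apply/(mutinf_eq0P _ cok) => msg o.
rewrite /pobs (bigD1 msg) //= big1 ?addr0 => [|msg']; last first.
  by rewrite (tuple0 msg) (tuple0 msg') eqxx.
by rewrite /msg_prob /= expn0 invr1 mul1r.
Qed.

Lemma message_blocks (n D m : nat) :
  exists (W : (n * D * m).-tuple bool -> nat -> {ffun 'I_D -> sym m})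
    (psi : (nat -> {ffun 'I_D -> sym m}) -> (n * D * m).-tuple bool),
  forall msg g, (forall t, (0 < t <= n)%N -> g t = W msg t) -> psi g = msg.
Proof.
have [|f [f' fK _]] := @eq_card_bij ((n * D * m).-tuple bool)
    {ffun 'I_n -> {ffun 'I_D -> sym m}}.
  rewrite card_tuple card_bool !card_ffun !card_ord card_sym -!expnM.
  by congr (_ ^ _)%N; lia.
exists (fun msg t => if insub t.-1 is Some i then f msg i else [ffun=> 0]).
exists (fun g => f' [ffun i : 'I_n => g i.+1]) => msg g e.
rewrite -[RHS]fK; congr f'; apply/ffunP => i; rewrite ffunE e ?ltn_ord //.
by rewrite /= valK.
Qed.

Lemma achievable_rate (R : realType) (C D zrw zro zwo : nat) (e : R) :
    (0 < D)%N -> (zrw + zro + D <= C)%N -> (zrw + zwo + D <= C)%N -> 0 < e ->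
  achievable C zrw zro zwo (D%:R - e).
Proof.
move=> D0 rD wD e0 eps eps0.
(* The number of times that carry no data; a block length at least [ovh * D / e] makes the lost rate
   at most [e]. *)
pose ovh := (2 + 3 * C)%N.
exists (ovh + Num.bound ((ovh * D)%:R / e))%N => N NN0.
have [n NE] : exists n, N = blocklen C n.
  by exists (N - ovh)%N; rewrite /blocklen /pw; move: NN0; rewrite /ovh; lia.
have eN : (ovh * D)%:R <= e * N%:R.
  rewrite mulrC -ler_pdivrMr //; apply: le_trans (ltW (archi_boundP _)) _.
    by rewrite divr_ge0 ?ler0n ?ltW.
  by rewrite ler_nat; apply: leq_trans NN0; apply: leq_addl.
(* Through [m < 2 ^ m], the summands yield [n.+1 < 2 ^ m], [C <= 2 ^ m] and an error bound
   [C / 2 ^ m] below [eps]. *)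
pose m := (n.+2 + C + Num.bound (C%:R / eps))%N.
have m2 : (m < 2 ^ m)%N by apply: ltn_expl.
have m0 : (0 < m)%N by [].
exists m; split=> //; subst N; move: eN => {NN0} eN.
have [||H mdsH] := @mds_exists C D m m0; first by lia.
  by rewrite ltnW // (leq_trans _ m2) // ltnS /m; lia.
have [W [psi psiW]] := message_blocks n D m.
have C0 : (0 < C)%N by lia.
exists (@scheme R C D n m _ H W psi); split; first exact: scheme_ok.
split.
  rewrite /= !natrM mulrA ler_pM2r ?ltr0n // mulrBl lerBlDr.
  apply: le_trans (_ : (n * D)%:R + (ovh * D)%:R <= _).
    by rewrite -natrD -natrM ler_nat /blocklen /pw /ovh; nia.
  by rewrite -natrM lerD2l.
move=> a aok; have ja := adv_ok_causal aok.
have [_ [_ [_ [crw [cro [cwo _]]]]]] := aok.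
have cU (S T : {set 'I_C}) s t : (#|S| <= s)%N -> (#|T| <= t)%N ->
    (s + t + D <= C)%N -> (#|S :|: T| + D <= C)%N.
  by move=> Ss Tt; have := (cardsU S T, subset_leq_card (subsetIl S T)) => -[]; lia.
have aw : (#|Zw a| + D <= C)%N := cU _ _ _ _ crw cwo wD.
have ar : (#|Zr a| + D <= C)%N := cU _ _ _ _ crw cro rD.
split; last exact: scheme_secret.
apply: le_lt_trans (scheme_reliable R C0 mdsH ja aw ar D0 _ psiW) _.
  by apply: leq_trans m2; rewrite /m; lia.
rewrite ltr_pdivrMr ?ltr0n ?expn_gt0 // mulrC -ltr_pdivrMr //.
apply: lt_le_trans (archi_boundP _) _; first by rewrite divr_ge0 ?ler0n ?ltW.
by rewrite ler_nat ltnW // (leq_trans _ m2) // ltnS /m leq_addl.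
Qed.

Theorem theorem9 (R : realType) (C zrw zro zwo : nat) :
  (zrw + zro + zwo <= C)%N ->
  capacity C zrw zro zwo
    (if (zrw + zwo <= zrw + zro)%N
     then Num.max (0 : R) (C%:R - (zrw + zro)%:R)
     else Num.max (0 : R) (C%:R - (zrw + zwo)%:R)).
Proof.
move=> hC; pose D := (C - maxn (zrw + zro) (zrw + zwo))%N.
(* Truncated subtraction in [D] accounts for the maximum with 0. *)
have -> : (if (zrw + zwo <= zrw + zro)%N
     then Num.max (0 : R) (C%:R - (zrw + zro)%:R)
     else Num.max (0 : R) (C%:R - (zrw + zwo)%:R)) = D%:R.
  by case: ifP => le; rewrite -natrB ?max_r ?ler0n //; try lia;
     congr _%:R; rewrite /D; lia.
split=> [x /(achievable_le hC) [xr xw]|e e0].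
  by rewrite /D; case: (leqP (zrw + zro) (zrw + zwo)).
have [D0|D0] := posnP D.
  exists 0; split; first exact: achievable_zero.
  by rewrite D0 sub0r oppr_lt0.
exists (D%:R - e / 2); split; last by lra.
by apply: achievable_rate => //; rewrite ?divr_gt0 //; move: D0; rewrite /D; lia.
Qed.
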